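(* Let $E=0$ and assume $\gamma_{\min}^A<1<\gamma_{\max}^A<2$, $1\in I_R$ and $1\in I_K$. Then every eigenvalue $\lambda$ of $\mathcal{P}^{-1}\mathcal{A}$ either belongs to $I_-\cup I_+$, or is a solution of the cubic polynomial equation $$\pi(\lambda;\gamma_A,\gamma_R,\gamma_K)\equiv(1+\lambda)^2(\gamma_A-\lambda)\gamma_K+p(\lambda;\gamma_A,\gamma_R)\,\lambda\,(1+\gamma_K)=0$$ for some $\gamma_A\in I_A$, $\gamma_R\in I_R$, $\gamma_K\in I_K$.
   Context: Let $n\ge m\ge p$ be positive integers, $A\in\mathbb{R}^{n\times n}$ symmetric positive definite (SPD), $B\in\mathbb{R}^{m\times n}$ and $C\in\mathbb{R}^{p\times m}$ of full row rank. With $E=0$, $$\mathcal{A}=\begin{bmatrix}A&B^\top&0\\ B&0&C^\top\\ 0&C&0\end{bmatrix}.$$ Let $\widehat A$ be an SPD approximation of $A$; $\widetilde S=B\widehat A^{-1}B^\top$ and $\widehat S$ an SPD approximation of $\widetilde S$; $\widetilde X=C\widehat S^{-1}C^\top$ and $\widehat X$ an SPD approximation of $\widetilde X$ (each hatted matrix is an SPD matrix of the appropriate size). The preconditioner is $\mathcal{P}=\mathcal{P}_L\mathcal{P}_D^{-1}\mathcal{P}_L^\top$ with $$\mathcal{P}_L=\begin{bmatrix}\widehat A&0&0\\ B&-\widehat S&0\\ 0&C&\widehat X\end{bmatrix},\qquad \mathcal{P}_D=\begin{bmatrix}\widehat A&0&0\\ 0&\widehat S&0\\ 0&0&\widehat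 X\end{bmatrix}.$$ Put $K=\widehat X^{-1/2}C\widehat S^{-1/2}$ and define the intervals $I_A=[\gamma_{\min}^A,\gamma_{\max}^A]$, $I_R=[\gamma_{\min}^R,\gamma_{\max}^R]$, $I_K=[\gamma_{\min}^K,\gamma_{\max}^K]$, whose endpoints are the smallest and largest eigenvalues of $\widehat A^{-1}A$, of $\widehat S^{-1}\widetilde S$, and of $KK^\top$, respectively (for $E=0$, $KK^\top=\widehat X^{-1/2}\widetilde X\widehat X^{-1/2}$). Define $p(\lambda;\gamma_A,\gamma_R)=\lambda^2-\lambda(\gamma_A\gamma_R+\gamma_A-2\gamma_R)-\gamma_R$, with roots $\lambda_\pm(\gamma_A,\gamma_R)=\eta\pm\sqrt{\eta^2+\gamma_R}$, where $\eta=\tfrac12(\gamma_R+1)\gamma_A-\gamma_R$. Define $$I_-=[\lambda_-(\gamma_{\min}^A,\gamma_{\max}^R),\lambda_-(\gamma_{\max}^A,\gamma_{\min}^R)],\qquad I_+=[\gamma_{\min}^A,\lambda_+(\gamma_{\max}^A,\gamma_{\max}^R)].$$ *)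

(* Defs.v *)
From mathcomp Require Import all_boot all_order all_algebra.
From mathcomp Require Import complex.
From mathcomp Require Import boolp classical_sets reals.

Set Implicit Arguments.
Unset Strict Implicit.
Unset Printing Implicit Defensive.

Import Order.TTheory GRing.Theory Num.Theory.
Local Open Scope ring_scope.

Definition spd (R : realType) (n : nat) (M : 'M[R]_n) : Prop :=
  M^T = M /\ forall x : 'cV[R]_n, x != 0 -> 0 < (x^T *m M *m x) 0 0.

(* An SPD matrix has exactly one SPD square root, so the default value [0] is
   not used on SPD arguments. *)
Definition spd_sqrt (R : realType) (n : nat) (M : 'M[R]_n) : 'M[R]_n :=
  xget 0 [set S : 'M[R]_n | spd S /\ S *m S = M].

Definition spd_invsqrt (R : realType) (n : nat) (M : 'M[R]_n) : 'M[R]_n :=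
  invmx (spd_sqrt M).

(* The matrices to which this is applied below are similar to real symmetric
   ones, so that all their complex eigenvalues are real. *)
Definition extreme_eigenvalues (R : realType) (n : nat) (M : 'M[R]_n)
    (gmin gmax : R) : Prop :=
  [/\ eigenvalue M gmin, eigenvalue M gmax &
      forall g : R, eigenvalue M g -> gmin <= g <= gmax].

Definition complex_eigenvalue (R : realType) (n : nat) (M : 'M[R]_n)
    (lambda : R[i]) : Prop :=
  eigenvalue (map_mx (real_complex R) M) lambda.

Section Matrices.
Variables (R : realType) (n m p : nat).
Variables (B : 'M[R]_(m, n)) (C : 'M[R]_(p, m)).

Definition saddle_mx (A : 'M[R]_n) : 'M[R]_(n + (m + p)) :=
  block_mx A               (row_mx B^T 0)
           (col_mx B 0)    (block_mx 0 C^T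
                                     C 0).

Definition precond_L (Ah : 'M[R]_n) (Sh : 'M[R]_m) (Xh : 'M[R]_p) :
    'M[R]_(n + (m + p)) :=
  block_mx Ah              0
           (col_mx B 0)    (block_mx (- Sh) 0
                                     C      Xh).

Definition precond_D (Ah : 'M[R]_n) (Sh : 'M[R]_m) (Xh : 'M[R]_p) :
    'M[R]_(n + (m + p)) :=
  block_mx Ah 0
           0  (block_mx Sh 0
                        0  Xh).

Definition precond (Ah : 'M[R]_n) (Sh : 'M[R]_m) (Xh : 'M[R]_p) :
    'M[R]_(n + (m + p)) :=
  precond_L Ah Sh Xh *m invmx (precond_D Ah Sh Xh) *m (precond_L Ah Sh Xh)^T.

Definition schurS (Ah : 'M[R]_n) : 'M[R]_m := B *m invmx Ah *m B^T.

Definition Kmx (Sh : 'M[R]_m) (Xh : 'M[R]_p) : 'M[R]_(p, m) :=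
  spd_invsqrt Xh *m C *m spd_invsqrt Sh.

End Matrices.

Definition p_quad (F : comNzRingType) (l gA gR : F) : F :=
  l ^+ 2 - l * (gA * gR + gA - 2 * gR) - gR.

Definition pi_cubic (F : comNzRingType) (l gA gR gK : F) : F :=
  (1 + l) ^+ 2 * (gA - l) * gK + p_quad l gA gR * l * (1 + gK).

Definition eta (R : realType) (gA gR : R) : R := 2^-1 * (gR + 1) * gA - gR.

Definition lambda_minus (R : realType) (gA gR : R) : R :=
  eta gA gR - Num.sqrt (eta gA gR ^+ 2 + gR).

Definition lambda_plus (R : realType) (gA gR : R) : R :=
  eta gA gR + Num.sqrt (eta gA gR ^+ 2 + gR).

(* Main.v *)
(* A congruence by the square roots of [Ah], [Sh], [Xh] turns the pencil into
     A x + Q^T y = l (x + Q^T y),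
     Q x + K^T z = l (Q x + Q Q^T y + y - K^T z),
     K y = l (- K y + K K^T z + z),
   with a positive definite right-hand side, so [l] is real and the eigenvector
   may be taken real.  Moreover [l <> 0].  For [l] outside [I_A], eliminating [x]
   gives [N y = (1 + l) K^T z] with
     N = (l - 1)^2 Q (A - l)^-1 Q^T + l (Q Q^T + 1),
   where [(gA - l) u^T N u = - p(l; gA, gR) |u|^2] for some [gA], [gR] in [I_A],
   [I_R] depending on [u].
   - If [N] or [- N] is positive definite, then [z <> 0]; comparing [y^T N y] with
     [|N y|^2], that is with Rayleigh quotients at [N^(1/2) y], gives the cubic
     with [gK = |K^T z|^2 / |z|^2].  Eliminating [y] rather than [z] is essential
     here: Rayleigh quotients of [K^T K] may fall below [I_K].  This covers
     [0 < l < min I_A], and also [l < 0] when [p(l; ., .) > 0] on the whole box;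
     otherwise [l < 0] lies in [I_-] by monotonicity of [p].
   - If [l > max I_A], Cauchy-Schwarz gives [pi <= 0] at a point of the box, while
     [pi(l; 1, 1, 1) = (l - 1)^2 (l + 1) > 0]; conclude by the intermediate value
     theorem on a segment of the box.
   - [I_A] itself is contained in [I_+], since [p(gA; gA, gR) <= 0]. *)

Require Import Defs.
From mathcomp Require Import all_boot all_order all_algebra.
From mathcomp Require Import complex.
From mathcomp Require Import boolp classical_sets reals.
From mathcomp Require Import ring lra.

Import Order.TTheory GRing.Theory Num.Theory.
Local Open Scope ring_scope.

Set Implicit Arguments.
Unset Strict Implicit.
Unset Printing Implicit Defensive.

(** * Square roots of real symmetric matrices *)

(** Newton's step: the correction at a new node is a multiple of [w], whose roots are exactly the
    old nodes. Interpolating a root function makes matrix roots polynomials in the matrix, hence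
    symmetric. *)
Lemma poly_interpolation (F : fieldType) (f : F -> F) (s : seq F) :
  exists q : {poly F}, forall x, x \in s -> q.[x] = f x.
Proof.
elim: s => [|a s [q qP]]; first by exists 0.
have [a_s|aNs] := boolP (a \in s).
  by exists q => x; rewrite inE => /orP[/eqP->|]; apply: qP.
pose w := \prod_(b <- s) ('X - b%:P).
have w_s x : x \in s -> w.[x] = 0.
  by move=> xs; apply/eqP; rewrite -rootE root_prod_XsubC.
have w_a : w.[a] != 0 by rewrite -rootE root_prod_XsubC.
exists (q + ((f a - q.[a]) / w.[a]) *: w) => x; rewrite inE !hornerE.
case/orP => [/eqP->|xs]; first by rewrite divfK // addrC subrK.
by rewrite (w_s x xs) mulr0 addr0 qP.
Qed.

(* Complex spectral theorem, brought back to the reals: [M] is killed by a real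
   polynomial with simple roots, all of them eigenvalues. *)
Lemma sym_horner_mx0 (R : rcfType) (n : nat) (M : 'M[R]_n.+1) : M^T = M ->
  exists2 s : seq R, {subset s <= eigenvalue M} &
    forall q : {poly R}, (forall x, x \in s -> q.[x] = 0) -> horner_mx M q = 0.
Proof.
move=> Msym; pose f := real_complex R; pose Mc := map_mx f M.
have Mc_herm : Mc \is hermsymmx.
  apply: realsym_hermsym.
    by apply/is_hermitianmxP; rewrite expr0 scale1r map_mx_id // map_trmx Msym.
  by apply/mxOverP => i j; rewrite mxE; apply/complex_realP; exists (M i j).
have /hermitian_normalmx/orthomx_spectralP := Mc_herm.
have d_real := hermitian_spectral_diag_real Mc_herm.
set P := spectralmx Mc; set d := spectral_diag Mc; move=> McE.
have Pu : P \in unitmx := spectral_unit Mc.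
have dE i : d 0 i = f (complex.Re (d 0 i)) by rewrite [f _]RRe_real // (mxOverP d_real).
exists [seq complex.Re (d 0 i) | i : 'I_n.+1].
  move=> _ /mapP[i _ ->]; rewrite -topredE /= eigenvalue_root_char.
  (* Being an eigenvalue is tested on the characteristic polynomial, which passes from [R[i]] back
     to [R]. *)
  rewrite -(fmorph_root f) map_char_poly -/Mc.
  rewrite [X in root _ X](_ : _ = d 0 i); last exact: esym (dE i).
  rewrite -eigenvalue_root_char.
  apply/eigenvalueP; exists (row i P).
    by rewrite {1}McE rowE !mulmxA mulmxK // -[_ *m diag_mx _]rowE row_diag_mx -scalemxAl.
  apply/eqP => r0; have : delta_mx 0 i *m P *m invmx P = 0 :> 'rV_n.+1.
    by rewrite -rowE r0 mul0mx.
  by rewrite mulmxK // => /matrixP/(_ 0 i)/eqP; rewrite !mxE !eqxx oner_eq0.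
move=> q q0; apply/eqP; rewrite -(map_mx_eq0 f) map_horner_mx -/Mc McE.
rewrite horner_mx_uconjC // horner_mx_diag.
suff -> : map_mx (horner (map_poly f q)) d = 0.
  by rewrite (_ : diag_mx 0 = 0) ?mulmx0 ?mul0mx //; apply/matrixP=> i j; rewrite !mxE mul0rn.
apply/rowP => i; rewrite !mxE dE horner_map q0 ?rmorph0 //.
by apply/mapP; exists i; rewrite // mem_enum.
Qed.

Lemma trmx_horner_mx (R : comNzRingType) (n : nat) (M : 'M[R]_n.+1) (q : {poly R}) :
  M^T = M -> (horner_mx M q)^T = horner_mx M q.
Proof.
move=> Msym; elim/poly_ind: q => [|q c IH]; first by rewrite rmorph0 trmx0.
rewrite rmorphD rmorphM /= horner_mx_X horner_mx_C linearD /= tr_scalar_mx.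
rewrite -mulmxE trmx_mul Msym IH.
by congr (_ + _); apply/comm_mx_horner/comm_mx_refl.
Qed.

(** [T] interpolates the fourth root, not the square root: [T *m T] is then a root of [M] that is
    itself positive semidefinite, its form at [x] being [|T x|^2]. *)
Lemma sym_psd_root (R : rcfType) (n : nat) (M : 'M[R]_n) : M^T = M ->
    (forall g, eigenvalue M g -> 0 <= g) ->
  exists2 T : 'M[R]_n, T^T = T & T *m T *m (T *m T) = M.
Proof.
case: n M => [|n] M Msym M_ge0; first by exists 0; rewrite !flatmx0 // [RHS]flatmx0.
have [s s_eig s0] := sym_horner_mx0 Msym.
have [q qP] := poly_interpolation (fun x => Num.sqrt (Num.sqrt x)) s.
exists (horner_mx M q); first exact: trmx_horner_mx.
have : horner_mx M (q ^+ 4 - 'X) = 0.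
  apply: s0 => x xs; rewrite !hornerE qP // (exprM _ 2 2) !sqr_sqrtr ?sqrtr_ge0 ?subrr //.
  exact/M_ge0/s_eig.
rewrite rmorphB rmorphXn /= horner_mx_X => /eqP; rewrite subr_eq0 => /eqP ME.
by rewrite -[RHS]ME (exprM _ 2 2) !expr2 !mulmxE.
Qed.

(** * Quadratic forms *)

Definition dot (R : comNzRingType) (n : nat) (x y : 'cV[R]_n) : R := (x^T *m y) 0 0.

Section Dot.
Variable R : comNzRingType.
Implicit Type n : nat.

Lemma dotE n (x y : 'cV[R]_n) : dot x y = \sum_i x i 0 * y i 0.
Proof. by rewrite /dot mxE; apply: eq_bigr => i _; rewrite mxE. Qed.

Lemma dotC n (x y : 'cV[R]_n) : dot x y = dot y x.
Proof. by rewrite !dotE; apply: eq_bigr => i _; rewrite mulrC. Qed.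

Lemma dotDr n (x y z : 'cV[R]_n) : dot x (y + z) = dot x y + dot x z.
Proof. by rewrite /dot mulmxDr mxE. Qed.

Lemma dotDl n (x y z : 'cV[R]_n) : dot (x + y) z = dot x z + dot y z.
Proof. by rewrite dotC dotDr !(dotC z). Qed.

Lemma dotZr n a (x y : 'cV[R]_n) : dot x (a *: y) = a * dot x y.
Proof. by rewrite /dot -scalemxAr mxE. Qed.

Lemma dotZl n a (x y : 'cV[R]_n) : dot (a *: x) y = a * dot x y.
Proof. by rewrite dotC dotZr dotC. Qed.

Lemma dotNr n (x y : 'cV[R]_n) : dot x (- y) = - dot x y.
Proof. by rewrite -scaleN1r dotZr mulN1r. Qed.

Lemma dotNl n (x y : 'cV[R]_n) : dot (- x) y = - dot x y.
Proof. by rewrite dotC dotNr dotC. Qed.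

Lemma dotBr n (x y z : 'cV[R]_n) : dot x (y - z) = dot x y - dot x z.
Proof. by rewrite dotDr dotNr. Qed.

Lemma dotBl n (x y z : 'cV[R]_n) : dot (x - y) z = dot x z - dot y z.
Proof. by rewrite dotDl dotNl. Qed.

Lemma dot0l n (x : 'cV[R]_n) : dot 0 x = 0.
Proof. by rewrite /dot trmx0 mul0mx mxE. Qed.

Lemma dot0r n (x : 'cV[R]_n) : dot x 0 = 0.
Proof. by rewrite dotC dot0l. Qed.

Lemma dot_mulmxr n k (M : 'M[R]_(n, k)) (x : 'cV[R]_n) (y : 'cV[R]_k) :
  dot x (M *m y) = dot (M^T *m x) y.
Proof. by rewrite /dot trmx_mul trmxK mulmxA. Qed.

Lemma dot_quadE n (M : 'M[R]_n) (x : 'cV[R]_n) : (x^T *m M *m x) 0 0 = dot x (M *m x).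
Proof. by rewrite /dot mulmxA. Qed.

End Dot.

Definition dot_linE := (dotDl, dotDr, dotBl, dotBr, dotNl, dotNr, dotZl, dotZr).

Section RealDot.
Variables (R : realFieldType) (n : nat).
Implicit Types x y : 'cV[R]_n.

Lemma dot_ge0 x : 0 <= dot x x.
Proof. by rewrite dotE sumr_ge0 // => i _; rewrite -expr2 sqr_ge0. Qed.

Lemma dot_eq0 x : (dot x x == 0) = (x == 0).
Proof.
apply/idP/eqP => [|->]; last by rewrite dot0l.
rewrite dotE psumr_eq0 => [/allP x0|i _]; last by rewrite -expr2 sqr_ge0.
apply/colP => i; rewrite mxE; apply/eqP.
by have := x0 i (mem_index_enum i); rewrite /= mulf_eq0 orbb.
Qed.

Lemma dot_gt0 x : (0 < dot x x) = (x != 0).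
Proof. by rewrite lt0r dot_ge0 dot_eq0 andbT. Qed.

Lemma dot_CauchySchwarz x y : dot x y ^+ 2 <= dot x x * dot y y.
Proof.
have [->|y0] := eqVneq y 0; first by rewrite !dot0r mulr0 expr0n.
have yy : 0 < dot y y by rewrite dot_gt0.
have := dot_ge0 (dot y y *: x - dot x y *: y).
rewrite !dot_linE (dotC y x).
rewrite [X in 0 <= X](_ : _ = dot y y * (dot x x * dot y y - dot x y ^+ 2)); last ring.
by rewrite pmulr_rge0 // subr_ge0.
Qed.

End RealDot.

(** * Positive definite matrices, Rayleigh quotients and symmetric pencils *)

Section Spd.
Variable R : realType.
Implicit Types n m : nat.

Lemma spd_sym n (M : 'M[R]_n) : spd M -> M^T = M. Proof. by case. Qed.

Lemma spd_gt0 n (M : 'M[R]_n) (x : 'cV[R]_n) : spd M -> x != 0 -> 0 < dot x (M *m x).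
Proof. by case=> _ M_gt0 /M_gt0; rewrite dot_quadE. Qed.

Lemma mulmx_inj_unit n (M : 'M[R]_n) :
  (forall x : 'cV[R]_n, M *m x = 0 -> x = 0) -> M \in unitmx.
Proof.
move=> M0; rewrite -unitmx_tr -row_free_unit -kermx_eq0; apply/eqP/row_matrixP => i.
rewrite row0; apply: trmx_inj; rewrite trmx0; apply: M0.
by apply: trmx_inj; rewrite trmx_mul trmxK -row_mul mulmx_ker row0 trmx0.
Qed.

Lemma spd_unit n (M : 'M[R]_n) : spd M -> M \in unitmx.
Proof.
move=> sM; apply: mulmx_inj_unit => x Mx; apply/eqP/contraT => /(spd_gt0 sM).
by rewrite Mx dot0r ltxx.
Qed.

(** [eigenvalue] speaks of row vectors; symmetry transposes them into the columns used by [dot]. *)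
Lemma sym_eigenvalueP n (M : 'M[R]_n) (g : R) : M^T = M ->
  reflect (exists2 x : 'cV[R]_n, x != 0 & M *m x = g *: x) (eigenvalue M g).
Proof.
move=> Msym; apply: (iffP eigenvalueP) => [[v vM v0]|[x x0 Mx]].
  exists v^T; rewrite ?trmx_eq0 //; apply: trmx_inj.
  by rewrite trmx_mul trmxK Msym vM linearZ /= trmxK.
by exists x^T; rewrite ?trmx_eq0 // -{1}Msym -trmx_mul Mx linearZ.
Qed.

Lemma spd_eigenvalue_gt0 n (M : 'M[R]_n) (g : R) : spd M -> eigenvalue M g -> 0 < g.
Proof.
move=> sM /(sym_eigenvalueP _ (spd_sym sM))[x x0 Mx].
have := spd_gt0 sM x0; rewrite Mx dotZr pmulr_lgt0 //.
by rewrite dot_gt0.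
Qed.

Lemma spd_root n (M : 'M[R]_n) : spd M -> exists S : 'M[R]_n, spd S /\ S *m S = M.
Proof.
move=> sM; have M_ge0 g : eigenvalue M g -> 0 <= g by move/(spd_eigenvalue_gt0 sM)/ltW.
have [T Tsym TM] := sym_psd_root (spd_sym sM) M_ge0.
exists (T *m T); split=> //; split=> [|x x0]; first by rewrite trmx_mul Tsym.
rewrite dot_quadE -mulmxA dot_mulmxr Tsym dot_gt0.
apply: contraNneq x0 => Tx.
by rewrite -(mulKmx (spd_unit sM) x) -TM -!mulmxA Tx !mulmx0.
Qed.

(** The existence of a root rules out the default value of [xget]. *)
Lemma spd_sqrtP n (M : 'M[R]_n) : spd M -> spd (spd_sqrt M) /\ spd_sqrt M *m spd_sqrt M = M.
Proof. by move=> /spd_root[S SM]; rewrite /spd_sqrt; case: xgetP => [_ -> //|/(_ S)]. Qed.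

(* Both quadratic forms of [M] and of [M^-1] range over the Rayleigh quotients
   [dot u (M *m u) / dot u u]; here [u] is [M^(1/2) *m v]. *)
Lemma spd_stretch n (M : 'M[R]_n) (v : 'cV[R]_n) : spd M -> v != 0 ->
  exists u : 'cV[R]_n, [/\ u != 0, dot u u = dot v (M *m v) &
    dot u (M *m u) = dot (M *m v) (M *m v)].
Proof.
move=> sM v0; have [S [sS SM]] := spd_root sM.
exists (S *m v); rewrite -SM -!mulmxA; split.
- by apply: contraNneq v0 => Sv; rewrite -(mulKmx (spd_unit sS) v) Sv mulmx0.
- by rewrite [RHS]dot_mulmxr (spd_sym sS).
- by rewrite [LHS]dot_mulmxr (spd_sym sS).
Qed.

(** [M - a%:M] has nonnegative eigenvalues, hence a symmetric fourth root [T], and its form at [x]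
    is [|T (T x)|^2]. *)
Lemma rayleigh_ge n (M : 'M[R]_n) (a : R) (x : 'cV[R]_n) : M^T = M ->
  (forall g, eigenvalue M g -> a <= g) -> a * dot x x <= dot x (M *m x).
Proof.
move=> Msym M_ge; have Nsym : (M - a%:M)^T = M - a%:M by rewrite linearB /= Msym tr_scalar_mx.
have N_ge0 g : eigenvalue (M - a%:M) g -> 0 <= g.
  move=> /(sym_eigenvalueP _ Nsym)[y y0 My].
  rewrite -(lerD2r a) add0r; apply/M_ge/sym_eigenvalueP => //; exists y => //.
  by rewrite scalerDl -My mulmxBl mul_scalar_mx subrK.
have [T Tsym TM] := sym_psd_root Nsym N_ge0.
have := dot_ge0 (T *m (T *m x)).
have -> : dot (T *m (T *m x)) (T *m (T *m x)) = dot x ((M - a%:M) *m x).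
  by rewrite -TM -!mulmxA [RHS]dot_mulmxr Tsym [RHS]dot_mulmxr Tsym.
by rewrite mulmxBl mul_scalar_mx dotBr dotZr subr_ge0.
Qed.

Lemma rayleigh_le n (M : 'M[R]_n) (b : R) (x : 'cV[R]_n) : M^T = M ->
  (forall g, eigenvalue M g -> g <= b) -> dot x (M *m x) <= b * dot x x.
Proof.
move=> Msym M_le; have Nsym : (- M)^T = - M by rewrite linearN /= Msym.
rewrite -lerN2 -dotNr -mulNr -mulNmx; apply: rayleigh_ge => // g.
move=> /(sym_eigenvalueP _ Nsym)[y y0 My]; rewrite lerNl; apply/M_le/sym_eigenvalueP => //.
by exists y; rewrite // scaleNr -My mulNmx opprK.
Qed.

Lemma eigenvalue_conj n (H M : 'M[R]_n) (g : R) : H \in unitmx ->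
  eigenvalue (invmx H *m M *m H) g = eigenvalue M g.
Proof.
move=> Hu; apply/eigenvalueP/eigenvalueP => -[v vM v0].
  exists (v *m invmx H).
    by rewrite scalemxAl -vM !mulmxA mulmxK.
  by apply: contraNneq v0 => v0; rewrite -(mulmxKV Hu v) v0 mul0mx.
exists (v *m H); first by rewrite !mulmxA mulmxK // vM scalemxAl.
by apply: contraNneq v0 => v0; rewrite -(mulmxK Hu v) v0 mul0mx.
Qed.

Lemma extreme_rayleigh n (M : 'M[R]_n) (a b : R) (x : 'cV[R]_n) : M^T = M ->
  extreme_eigenvalues M a b -> a * dot x x <= dot x (M *m x) <= b * dot x x.
Proof.
by move=> Msym [_ _ M_ab]; rewrite rayleigh_ge ?rayleigh_le // => g /M_ab/andP[].
Qed.

(** Rayleigh bounds are stated for symmetric matrices, whereas [invmx Ah *m A] and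
    [invmx Sh *m schurS B Ah] are only similar to such matrices. *)
Lemma extreme_conj n (H M : 'M[R]_n) (a b : R) : H \in unitmx ->
  extreme_eigenvalues (invmx H *m M *m H) a b -> extreme_eigenvalues M a b.
Proof.
move=> Hu [Ma Mb M_ab]; split; rewrite -1?(eigenvalue_conj _ _ Hu) //.
by move=> g; rewrite -(eigenvalue_conj _ _ Hu); apply: M_ab.
Qed.

(* With [lambda = r + i s] and eigenvector [a + i b], symmetry of [M] cancels the
   cross terms and leaves [s (dot a (N a) + dot b (N b)) = 0]. *)
Lemma sym_pencil_real n (M N : 'M[R]_n) (lambda : R[i]) : M^T = M -> spd N ->
  complex_eigenvalue (invmx N *m M) lambda ->
  exists l : R, lambda = real_complex R l /\
    exists2 x : 'cV[R]_n, x != 0 & M *m x = l *: (N *m x).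
Proof.
(* The row [v] turns the eigenvalue equation into the symmetric pencil [v M = lambda v N]. *)
move=> Msym sN /eigenvalueP[w]; pose v := w *m map_mx (real_complex R) (invmx N).
have Nu := spd_unit sN; have Nsym := spd_sym sN.
rewrite map_mxM mulmxA -/v => vM w0.
have wE : w = v *m map_mx (real_complex R) N.
  by rewrite -mulmxA -map_mxM mulVmx // map_mx1 mulmx1.
have v0 : v != 0 by apply: contraNneq w0 => v0; rewrite wE v0 mul0mx.
case: lambda vM => r s vM; move: v vM wE v0 => v vM wE v0.
pose a : 'cV[R]_n := \col_i complex.Re (v 0 i); pose b : 'cV[R]_n := \col_i complex.Im (v 0 i).
(* A real symmetric matrix acts on the row [v] as on the columns [a] and [b] of its real and
   imaginary parts. *)
have ReM (S : 'M[R]_n) j : S^T = S ->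
    (v *m map_mx (real_complex R) S) 0 j = Complex ((S *m a) j 0) ((S *m b) j 0).
  move=> Ssym; rewrite -{2 3}Ssym !mxE; apply/eqP; rewrite eq_complex; apply/andP; split; apply/eqP.
    rewrite raddf_sum; apply: eq_bigr => k _; rewrite !mxE; case: (v 0 k) => c d /=.
    by rewrite /= mulr0 subr0 mulrC.
  rewrite raddf_sum; apply: eq_bigr => k _; rewrite !mxE; case: (v 0 k) => c d /=.
  by rewrite mulr0 add0r mulrC.
have abM : M *m a = r *: (N *m a) - s *: (N *m b) /\ M *m b = s *: (N *m a) + r *: (N *m b).
  split; apply/colP => j; have /matrixP/(_ 0 j) := vM; rewrite wE [RHS]mxE !ReM //.
    by move=> /(congr1 (@complex.Re R)) /=; rewrite !mxE.
  by move=> /(congr1 (@complex.Im R)) /=; rewrite !mxE => ->; rewrite addrC.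
have ab0 : (a != 0) || (b != 0).
  rewrite -negb_and; apply: contraNN v0 => /andP[/eqP a0 /eqP b0]; apply/eqP/rowP => j.
  have /colP/(_ j) := a0; have /colP/(_ j) := b0; rewrite !mxE.
  by case: (v 0 j) => c d /= -> ->.
have [aM bM] := abM.
have s0 : s = 0.
  have := dot_mulmxr M a b; rewrite Msym aM bM !dot_linE.
  have -> : dot (N *m a) b = dot a (N *m b) by rewrite [RHS]dot_mulmxr Nsym.
  have -> : dot (N *m b) b = dot b (N *m b) by rewrite dotC.
  move=> eq_ab.
  have pos : 0 < dot a (N *m a) + dot b (N *m b).
    have ge0 (c : 'cV[R]_n) : 0 <= dot c (N *m c).
      by have [->|/(spd_gt0 sN)/ltW] := eqVneq c 0; rewrite ?dot0l.
    have := ge0 a; have := ge0 b.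
    by case/orP: ab0 => /(spd_gt0 sN) ? ? ?; lra.
  apply/eqP; have /eqP : s * (dot a (N *m a) + dot b (N *m b)) = 0 by rewrite mulrDr; lra.
  by rewrite mulf_eq0 (gt_eqF pos) orbF.
exists r; split; first by rewrite s0.
case/orP: ab0 => [a0|b0].
  by exists a => //; rewrite aM s0 scale0r subr0.
by exists b => //; rewrite bM s0 scale0r add0r.
Qed.

Lemma spd_congr n (L M : 'M[R]_n) : L \in unitmx -> spd M -> spd (L *m M *m L^T).
Proof.
move=> Lu sM; split=> [|x x0]; first by rewrite !trmx_mul trmxK (spd_sym sM) mulmxA.
rewrite dot_quadE -!mulmxA dot_mulmxr spd_gt0 //.
by apply: contraNneq x0 => Lx; rewrite -(mulKmx (_ : L^T \in unitmx) x) ?unitmx_tr // Lx mulmx0.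
Qed.

Lemma spd_gram n m (Q : 'M[R]_(m, n)) : row_free Q -> spd (Q *m Q^T).
Proof.
move=> Qfree; split=> [|x x0]; first by rewrite trmx_mul trmxK.
rewrite dot_quadE -mulmxA dot_mulmxr dot_gt0.
by rewrite -trmx_eq0 trmx_mul trmxK mulmx_free_eq0 // trmx_eq0.
Qed.

Lemma spd_inv n (M : 'M[R]_n) : spd M -> spd (invmx M).
Proof.
move=> sM; have := spd_congr (L := invmx M) _ sM; rewrite unitmx_inv => /(_ (spd_unit sM)).
by rewrite trmx_inv (spd_sym sM) mulVmx ?(spd_unit sM) // mul1mx.
Qed.

Lemma dot_col_mx n m (x x' : 'cV[R]_n) (y y' : 'cV[R]_m) :
  dot (col_mx x y) (col_mx x' y') = dot x x' + dot y y'.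
Proof. by rewrite /dot tr_col_mx mul_row_col mxE. Qed.

Lemma spd_block_diag n m (M : 'M[R]_n) (N : 'M[R]_m) :
  spd M -> spd N -> spd (block_mx M 0 0 N).
Proof.
move=> sM sN; split=> [|u u0]; first by rewrite tr_block_mx !trmx0 !spd_sym.
have dot_spd_ge0 k (S : 'M[R]_k) (x : 'cV[R]_k) : spd S -> 0 <= dot x (S *m x).
  by move=> sS; have [->|/(spd_gt0 sS)/ltW//] := eqVneq x 0; rewrite dot0l.
rewrite dot_quadE -(vsubmxK u) mul_block_col !mul0mx addr0 add0r dot_col_mx.
have [x0|x0] := eqVneq (usubmx u) 0; last by rewrite ltr_pwDl ?dot_spd_ge0 ?spd_gt0.
rewrite ltr_wpDl ?dot_spd_ge0 ?spd_gt0 //; apply: contraNneq u0 => y0.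
by rewrite -(vsubmxK u) x0 y0 col_mx0.
Qed.

End Spd.

(** * The polynomials p and pi *)

Section Scalars.
Variable R : realType.
Implicit Types l a b c : R.

(** On a segment of the parameter box [pi_cubic l] is a polynomial in [t], so the intermediate value
    theorem for polynomials applies. *)
Lemma pi_cubic_segment_root l (a0 b0 c0 a1 b1 c1 : R) :
    pi_cubic l a0 b0 c0 <= 0 -> 0 <= pi_cubic l a1 b1 c1 ->
  exists t : R, [/\ 0 <= t, t <= 1 & pi_cubic l (a0 + t * (a1 - a0))
    (b0 + t * (b1 - b0)) (c0 + t * (c1 - c0)) = 0].
Proof.
move=> pi0 pi1.
pose q : {poly R} := pi_cubic l%:P (a0%:P + 'X * (a1 - a0)%:P)
  (b0%:P + 'X * (b1 - b0)%:P) (c0%:P + 'X * (c1 - c0)%:P).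
have qE t : q.[t] = pi_cubic l (a0 + t * (a1 - a0)) (b0 + t * (b1 - b0)) (c0 + t * (c1 - c0)).
  by rewrite /q /pi_cubic /p_quad; rewrite !(hornerE, hornerMn).
have q0 : q.[0] <= 0 by rewrite qE !mul0r !addr0.
have endE (u v : R) : u + 1 * (v - u) = v by rewrite mul1r addrC subrK.
have q1 : 0 <= q.[1] by rewrite qE !endE.
have [t] := @Num.Theory.poly_ivt R q 0 1 ler01 (introT andP (conj q0 q1)).
by rewrite rootE => /andP[t0 t1] /eqP; rewrite qE => qt; exists t.
Qed.

Lemma segment_itv a b (x y t : R) : x \in `[a, b] -> y \in `[a, b] ->
  0 <= t -> t <= 1 -> x + t * (y - x) \in `[a, b].
Proof. by rewrite !in_itv /= => /andP[? ?] /andP[? ?] ? ?; apply/andP; split; nra. Qed.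

Lemma p_quad_factor l a b : 0 <= b ->
  p_quad l a b = (l - lambda_minus a b) * (l - lambda_plus a b).
Proof.
move=> b0; have : Num.sqrt (eta a b ^+ 2 + b) ^+ 2 = eta a b ^+ 2 + b.
  by rewrite sqr_sqrtr // addr_ge0 ?sqr_ge0.
rewrite /p_quad /lambda_minus /lambda_plus; set s := Num.sqrt _ => sE.
have -> : (l - (eta a b - s)) * (l - (eta a b + s)) = (l - eta a b) ^+ 2 - s ^+ 2 by ring.
by rewrite sE /eta; field.
Qed.

Lemma lambda_plus_gt0 a b : 0 < b -> 0 < lambda_plus a b.
Proof.
move=> b0; rewrite /lambda_plus -ltrBlDl sub0r (le_lt_trans (ler_norm _)) // normrN -sqrtr_sqr.
by rewrite ltr_sqrt ?ltrDl ?ltr_wpDl ?sqr_ge0.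
Qed.

Lemma lambda_minus_le_plus a b : lambda_minus a b <= lambda_plus a b.
Proof. by rewrite lerD2l (le_trans _ (sqrtr_ge0 _)) // oppr_le0 sqrtr_ge0. Qed.

Lemma p_quad_le0 l a b : 0 <= b -> p_quad l a b <= 0 ->
  lambda_minus a b <= l <= lambda_plus a b.
Proof.
move=> b0; rewrite p_quad_factor // => p0; have := lambda_minus_le_plus a b.
move: p0; set u := lambda_minus a b; set v := lambda_plus a b => p0 uv.
by apply/andP; split; rewrite leNgt; apply/negP => ?; nra.
Qed.

(** As [lambda_plus] is positive, a negative [l] cannot lie beyond the larger root. *)
Lemma p_quad_ge0_neg l a b : 0 < b -> l < 0 -> 0 <= p_quad l a b ->
  l <= lambda_minus a b.
Proof.
move=> b0 l0; rewrite p_quad_factor ?(ltW b0) // => p0; have := lambda_plus_gt0 a b0.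
move: p0; set u := lambda_minus a b; set v := lambda_plus a b => p0 uv.
by rewrite leNgt; apply/negP => ?; nra.
Qed.

(* For [l < 0], [p] increases with [gA], and decreases with [gR] since [gA < 2]. *)
Lemma p_quad_mono_neg l (a a' b b' : R) : l < 0 -> 0 < b -> a' < 2 ->
  a <= a' -> b' <= b -> p_quad l a b <= p_quad l a' b'.
Proof.
move=> l0 b0 a2 aa bb; rewrite -subr_ge0.
have -> : p_quad l a' b' - p_quad l a b =
  (- l) * (a' - a) * (b + 1) + (b - b') * (1 + - l * (2 - a')).
  by rewrite /p_quad; ring.
have : 0 <= - l * (2 - a') by rewrite mulr_ge0 //; lra.
move=> ?; apply: addr_ge0; apply: mulr_ge0; rewrite ?mulr_ge0 //; lra.
Qed.

(** The regrouping of [- p_quad] is the one that [schur_mx] produces: the first term comes from the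
    resolvent of [A], the second from [Q *m Q^T + 1%:M]. *)
Lemma p_quad_neg l a b : 0 < l -> l < a -> 0 < b -> p_quad l a b < 0.
Proof.
move=> l0 la b0; rewrite -oppr_gt0.
have -> : - p_quad l a b = (l - 1) ^+ 2 * b + l * (b + 1) * (a - l).
  by rewrite /p_quad; ring.
apply: ltr_wpDl; first by rewrite mulr_ge0 ?sqr_ge0 // ltW.
by rewrite !mulr_gt0 ?subr_gt0 ?addr_gt0.
Qed.

Lemma p_quad_at_gA a b : 0 <= b -> p_quad a a b <= 0.
Proof.
move=> b0; have -> : p_quad a a b = - (b * (a - 1) ^+ 2) by rewrite /p_quad; ring.
by rewrite oppr_le0 mulr_ge0 ?sqr_ge0.
Qed.

Lemma rayleigh_quotient (a b q s : R) : 0 < s -> a * s <= q <= b * s ->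
  exists2 g : R, g \in `[a, b] & q = g * s.
Proof.
move=> s0 /andP[aq qb]; exists (q / s); last by rewrite divfK ?gt_eqF.
by rewrite in_itv /= ler_pdivlMr // ler_pdivrMr // aq qb.
Qed.

End Scalars.

(** * The symmetrized pencil *)

Section Symmetrized.
Variables (R : realType) (n m p : nat).
Variables (A : 'M[R]_n) (Q : 'M[R]_(m, n)) (K : 'M[R]_(p, m)).
Variables (a b c d e f : R).
Hypothesis Asym : A^T = A.
Hypothesis A_ab : forall x : 'cV[R]_n, a * dot x x <= dot x (A *m x) <= b * dot x x.
Hypothesis Q_cd : forall y : 'cV[R]_m,
  c * dot y y <= dot (Q^T *m y) (Q^T *m y) <= d * dot y y.
Hypothesis K_ef : forall z : 'cV[R]_p,
  e * dot z z <= dot (K^T *m z) (K^T *m z) <= f * dot z z.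
Hypotheses (a_gt0 : 0 < a) (c_gt0 : 0 < c) (e_gt0 : 0 < e).
Variable l : R.

Let T := A - l%:M.

Lemma shift_mulmx (x : 'cV[R]_n) : T *m x = A *m x - l *: x.
Proof. by rewrite mulmxBl mul_scalar_mx. Qed.

Lemma shift_sym : T^T = T.
Proof. by rewrite /T linearB /= Asym tr_scalar_mx. Qed.

Lemma shift_spd : l < a -> spd T.
Proof.
move=> la; split; first exact: shift_sym.
move=> x x0; rewrite dot_quadE shift_mulmx dotBr dotZr.
by have := A_ab x; have := x0; rewrite -dot_gt0 => ? /andP[? ?]; nra.
Qed.

Lemma shiftN_spd : b < l -> spd (- T).
Proof.
move=> bl; split; first by rewrite linearN /= shift_sym.
move=> x x0; rewrite dot_quadE mulNmx shift_mulmx dotNr dotBr dotZr.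
by have := A_ab x; have := x0; rewrite -dot_gt0 => ? /andP[? ?]; nra.
Qed.

Hypothesis l_ab : (l < a) || (b < l).

Lemma shift_unit : T \in unitmx.
Proof.
case/orP: l_ab => [/shift_spd/spd_unit//|/shiftN_spd/spd_unit].
by rewrite -scaleN1r unitmxZ // unitrN1.
Qed.

(** Write [w = T v] and stretch [v] by the square root of [T], or of [- T] above the spectrum. The
    resulting [u] has [|u|^2 = v^T w] up to that sign and [|u^T T u| = |w|^2], so [gA] is the
    Rayleigh quotient of [A] at [u]. *)
Lemma resolvent_quotient (w : 'cV[R]_n) : w != 0 ->
  exists2 gA : R, gA \in `[a, b] & dot w w = (gA - l) * dot w (invmx T *m w).
Proof.
move=> w0; pose v := invmx T *m w.
have wE : w = T *m v by rewrite mulKVmx ?shift_unit.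
have v0 : v != 0 by apply: contraNneq w0 => v0; rewrite wE v0 mulmx0.
case/orP: l_ab => [/shift_spd|/shiftN_spd] sT; have [u [u0 uu uTu]] := spd_stretch sT v0.
- have uu0 : 0 < dot u u by rewrite dot_gt0.
  have [gA gA_ab uAu] := rayleigh_quotient uu0 (A_ab u).
  exists gA => //; move: uTu uu; rewrite (shift_mulmx u) dotBr dotZr uAu -wE -/v.
  by rewrite dotC => <-; rewrite dotC => <-; rewrite mulrBl.
- have uu0 : 0 < dot u u by rewrite dot_gt0.
  have [gA gA_ab uAu] := rayleigh_quotient uu0 (A_ab u).
  exists gA => //; move: uTu uu; rewrite !mulNmx (shift_mulmx u) -wE !dot_linE uAu opprK -/v.
  by rewrite (dotC v) => <- uu; rewrite -(opprK (dot w v)) -uu; ring.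
Qed.

(* Schur complement of the symmetrized pencil, once [x] is eliminated. *)
Definition schur_mx : 'M[R]_m :=
  (l - 1) ^+ 2 *: (Q *m invmx T *m Q^T) + l *: (Q *m Q^T + 1%:M).

Lemma schur_mx_sym : schur_mx^T = schur_mx.
Proof.
rewrite /schur_mx linearD /= !linearZ /= linearD /= !trmx_mul !trmxK trmx1.
by rewrite trmx_inv shift_sym mulmxA.
Qed.

Lemma schur_mx_quotient (u : 'cV[R]_m) : u != 0 ->
  exists gA gR : R, [/\ gA \in `[a, b], gR \in `[c, d] &
    (gA - l) * dot u (schur_mx *m u) = - p_quad l gA gR * dot u u].
Proof.
rewrite -dot_gt0 => uu0; pose w := Q^T *m u.
have [gR gR_cd ww] := rayleigh_quotient uu0 (Q_cd u).
have gR0 : 0 < gR by move: gR_cd; rewrite in_itv => /andP[/(lt_le_trans c_gt0)].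
(* The bound [c > 0] makes [Q^T] injective, so the resolvent can be evaluated at [w]. *)
have w0 : w != 0 by rewrite -dot_gt0 ww mulr_gt0.
have [gA gA_ab wTw] := resolvent_quotient w0.
exists gA, gR; split=> //.
have -> : dot u (schur_mx *m u) =
    (l - 1) ^+ 2 * dot w (invmx T *m w) + l * (dot w w + dot u u).
  rewrite /schur_mx mulmxDl -!scalemxAl mulmxDl mul1mx -!mulmxA -/w !dot_linE.
  by rewrite !(dot_mulmxr Q).
rewrite mulrDr mulrCA -wTw ww /p_quad; ring.
Qed.

Variables (x : 'cV[R]_n) (y : 'cV[R]_m) (z : 'cV[R]_p).
Hypothesis E1 : A *m x + Q^T *m y = l *: (x + Q^T *m y).
Hypothesis E2 : Q *m x + K^T *m z =
  l *: (Q *m x + Q *m (Q^T *m y) + y - K^T *m z).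
Hypothesis E3 : K *m y = l *: (- (K *m y) + K *m (K^T *m z) + z).

Lemma x_resolvent : x = (l - 1) *: (invmx T *m (Q^T *m y)).
Proof.
rewrite scalemxAr; apply: (canRL (mulKmx shift_unit)); rewrite shift_mulmx.
move: E1; set r := Q^T *m y; set s := A *m x => E.
apply/colP => i; move/colP/(_ i): E; rewrite !mxE => E; lra.
Qed.

Lemma schur_mx_y : schur_mx *m y = (1 + l) *: (K^T *m z).
Proof.
have Qx : Q *m x = (l - 1) *: (Q *m (invmx T *m (Q^T *m y))) by rewrite scalemxAr -x_resolvent.
move: E2; rewrite Qx /schur_mx mulmxDl -!scalemxAl mulmxDl mul1mx -!mulmxA.
set r := Q *m (invmx _ *m _); set s := Q *m (_ *m _); set t := K^T *m z => E.
apply/colP => i; move/colP/(_ i): E; rewrite !mxE => E; lra.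
Qed.

(** Pairing [E3] with [z] expresses [(1 + l) z^T K y] through [z] alone, without dividing by
    [1 + l]. *)
Lemma dot_schur_mx_y :
  dot y (schur_mx *m y) = l * (dot (K^T *m z) (K^T *m z) + dot z z).
Proof.
rewrite schur_mx_y dotZr dot_mulmxr trmxK (dotC (K *m y)); have := congr1 (dot z) E3.
rewrite !dot_linE (dot_mulmxr K z (K^T *m z)) => E; lra.
Qed.

Lemma schur_mx_spd_cubic (s : R) : s * s = 1 -> spd (s *: schur_mx) -> y != 0 ->
  exists gA gR gK : R, [/\ gA \in `[a, b], gR \in `[c, d], gK \in `[e, f] &
    pi_cubic l gA gR gK = 0].
Proof.
move=> ss sN y0; have [u [u0 uu uNu]] := spd_stretch sN y0.
have [gA [gR [gA_ab gR_cd]]] := schur_mx_quotient u0.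
move: uu uNu; rewrite -!scalemxAl !dot_linE dot_schur_mx_y schur_mx_y !dot_linE => uu uNu uq.
(* By [dot_schur_mx_y], [z = 0] would give [|u|^2 = 0]. *)
have zz : 0 < dot z z.
  rewrite dot_gt0; apply: contraNneq u0 => z0.
  by rewrite -dot_eq0 uu z0 mulmx0 !dot0l addr0 !mulr0.
have [gK gK_ef kk] := rayleigh_quotient zz (K_ef z).
exists gA, gR, gK; split=> //; rewrite kk in uu uNu.
have sD : s * dot u u = l * (gK * dot z z + dot z z) by rewrite uu mulrA ss mul1r.
have sk : s * dot u (schur_mx *m u) = (1 + l) ^+ 2 * (gK * dot z z).
  by rewrite uNu -[RHS]mul1r -ss; ring.
(* The relation between [u^T N u] and [|u|^2] becomes the cubic once both are written in terms of
   [|z|^2]. *)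
have : pi_cubic l gA gR gK * dot z z = 0.
  transitivity ((gA - l) * (s * dot u (schur_mx *m u)) + p_quad l gA gR * (s * dot u u)).
    by rewrite sk sD /pi_cubic; ring.
  by rewrite mulrCA uq; ring.
by move/eqP; rewrite mulf_eq0 (gt_eqF zz) orbF => /eqP.
Qed.

Hypothesis xyz_neq0 : [|| x != 0, y != 0 | z != 0].

(** At [l = 0] the equations chain into [x^T Q^T y = - z^T K y = 0], so [x^T A x = 0] and [x = 0].
    Then [Q^T y = 0] and [K^T z = 0], and positivity of [c] and [e] makes [y] and [z] vanish. *)
Lemma eigenvalue_neq0 : l != 0.
Proof.
apply/eqP => l0; move: E1 E2 E3; rewrite l0 !scale0r => F1 F2 F3.
have x0 : x = 0.
  have xQy : dot x (Q^T *m y) = 0.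
    rewrite dot_mulmxr trmxK (_ : Q *m x = - (K^T *m z)); last by apply/eqP; rewrite -addr_eq0 F2.
    by rewrite dotNl dotC dot_mulmxr trmxK F3 dot0l oppr0.
  have xAx : dot x (A *m x) = 0.
    by have := congr1 (dot x) F1; rewrite dotDr xQy addr0 dot0r.
  apply/eqP/contraT; rewrite -dot_gt0 => xx.
  by have /andP[] := A_ab x; rewrite xAx leNgt mulr_gt0.
have Qy : Q^T *m y = 0 by move: F1; rewrite x0 mulmx0 add0r.
have Kz : K^T *m z = 0 by move: F2; rewrite x0 mulmx0 add0r.
case/or3P: xyz_neq0; first by rewrite x0 eqxx.
  by rewrite -dot_gt0 => yy; have /andP[] := Q_cd y; rewrite Qy dot0l leNgt mulr_gt0.
by rewrite -dot_gt0 => zz; have /andP[] := K_ef z; rewrite Kz dot0l leNgt mulr_gt0.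
Qed.

(** If [y = 0], then [dot_schur_mx_y] with [l] nonzero forces [z = 0], and [x_resolvent] forces
    [x = 0]. *)
Lemma eigenvector_y_neq0 : y != 0.
Proof.
apply/eqP => y0; have := dot_schur_mx_y; rewrite {1}y0 dot0l => /esym/eqP.
rewrite mulf_eq0 (negPf eigenvalue_neq0) /= paddr_eq0 ?dot_ge0 // !dot_eq0.
move=> /andP[_ /eqP z0].
have x0 : x = 0 by rewrite x_resolvent y0 !mulmx0 scaler0.
by move: xyz_neq0; rewrite x0 y0 z0 !eqxx.
Qed.

Hypotheses (a_lt1 : a < 1) (b_gt1 : 1 < b) (b_lt2 : b < 2).
Hypotheses (cd1 : 1 \in `[c, d]) (ef1 : 1 \in `[e, f]).

(** The sign of [schur_mx] is not controlled here, so quotients are taken at [y] itself. They only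
    give an inequality, which the point [(1, 1, 1)] of the box completes. *)
Lemma cubic_above : b < l ->
  exists gA gR gK : R, [/\ gA \in `[a, b], gR \in `[c, d], gK \in `[e, f] &
    pi_cubic l gA gR gK = 0].
Proof.
move=> bl; have yy : 0 < dot y y by rewrite dot_gt0 eigenvector_y_neq0.
have [gA [gR [gA_ab gR_cd yq]]] := schur_mx_quotient eigenvector_y_neq0.
have gAl : gA < l by move: gA_ab; rewrite in_itv /= => /andP[_ /le_lt_trans]; apply.
have l0 : 0 < l := lt_trans (lt_trans ltr01 b_gt1) bl.
have [gK gK_ef pi_le0] : exists2 gK, gK \in `[e, f] & pi_cubic l gA gR gK <= 0.
  (* With [z = 0] there is no quotient to define [gK], but [p_quad] vanishes, so [1] serves: what
     remains has the sign of [gA - l]. *)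
  have [z0|] := eqVneq z 0.
    exists 1 => //; move: yq; rewrite dot_schur_mx_y z0 mulmx0 !dot0l addr0 !mulr0.
    move=> /esym/eqP; rewrite mulf_eq0 oppr_eq0 (gt_eqF yy) orbF /pi_cubic => /eqP ->.
    by rewrite !mul0r addr0 mulr1 mulr_ge0_le0 ?sqr_ge0 // subr_le0 ltW.
  rewrite -dot_gt0 => zz; have [gK gK_ef kk] := rayleigh_quotient zz (K_ef z).
  exists gK => //.
  have gK0 : 0 < gK by move: gK_ef; rewrite in_itv => /andP[/(lt_le_trans e_gt0)].
  have yKz : (1 + l) * dot y (K^T *m z) = l * ((gK + 1) * dot z z).
    by rewrite -dotZr -schur_mx_y dot_schur_mx_y kk; ring.
  (* Cauchy-Schwarz for [y] and [K^T z], with one factor [|z|^2] cancelled. *)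
  have CS : (l * (gK + 1)) ^+ 2 * dot z z <= (1 + l) ^+ 2 * gK * dot y y.
    rewrite -(ler_pM2r zz).
    have -> : (l * (gK + 1)) ^+ 2 * dot z z * dot z z =
        (1 + l) ^+ 2 * dot y (K^T *m z) ^+ 2 by rewrite -exprMn yKz; ring.
    have := dot_CauchySchwarz y (K^T *m z); rewrite kk => H.
    apply: le_trans (ler_wpM2l (sqr_ge0 _) H) _; rewrite le_eqVlt; apply/orP; left.
    by apply/eqP; ring.
  rewrite -(pmulr_lle0 _ yy).
  have -> : pi_cubic l gA gR gK * dot y y = (gA - l) *
      ((1 + l) ^+ 2 * gK * dot y y - (l * (gK + 1)) ^+ 2 * dot z z).
    move: yq; rewrite dot_schur_mx_y kk /pi_cubic.
    move: (p_quad l gA gR) => P yq.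
    have -> : ((1 + l) ^+ 2 * (gA - l) * gK + P * l * (1 + gK)) * dot y y =
      (1 + l) ^+ 2 * (gA - l) * gK * dot y y - (- P * dot y y) * (l * (1 + gK)) by ring.
    by rewrite -yq; ring.
  by rewrite mulr_le0_ge0 ?subr_ge0 // subr_le0 ltW.
have pi_ge0 : 0 <= pi_cubic l 1 1 1.
  rewrite (_ : pi_cubic l 1 1 1 = (l - 1) ^+ 2 * (l + 1)); last by rewrite /pi_cubic /p_quad; ring.
  by rewrite mulr_ge0 ?sqr_ge0 //; lra.
have [t [t0 t1 pit]] := pi_cubic_segment_root pi_le0 pi_ge0.
have ab1 : 1 \in `[a, b] by rewrite in_itv /= !ltW.
by eexists; eexists; eexists; split; last exact: pit; apply: segment_itv.
Qed.

Lemma cubic_below : 0 < l -> l < a ->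
  exists gA gR gK : R, [/\ gA \in `[a, b], gR \in `[c, d], gK \in `[e, f] &
    pi_cubic l gA gR gK = 0].
Proof.
move=> l0 la; apply: (@schur_mx_spd_cubic 1); rewrite ?mulr1 ?scale1r //;
  last exact: eigenvector_y_neq0.
split=> [|u u0]; first exact: schur_mx_sym.
rewrite dot_quadE; have [gA [gR [gA_ab gR_cd uq]]] := schur_mx_quotient u0.
have gAl : l < gA by move: gA_ab; rewrite in_itv => /andP[/(lt_le_trans la)].
have gR0 : 0 < gR by move: gR_cd; rewrite in_itv => /andP[/(lt_le_trans c_gt0)].
rewrite -subr_gt0 in gAl; rewrite -(pmulr_rgt0 _ gAl) uq pmulr_lgt0 ?dot_gt0 //.
by rewrite oppr_gt0 p_quad_neg // -subr_gt0.
Qed.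

Lemma spectrum_negative : l < 0 ->
  l \in `[lambda_minus a d, lambda_minus b c] \/
  exists gA gR gK : R, [/\ gA \in `[a, b], gR \in `[c, d], gK \in `[e, f] &
    pi_cubic l gA gR gK = 0].
Proof.
move=> l0; have d_gt0 : 0 < d.
  by move: cd1; rewrite in_itv => /andP[_ /(lt_le_trans ltr01)].
(* For negative [l], [p_quad l] is smallest over the box at [(a, d)] and largest at [(b, c)]. *)
have box gA gR : gA \in `[a, b] -> gR \in `[c, d] ->
    [/\ 0 < gA - l, 0 < gR, p_quad l a d <= p_quad l gA gR & p_quad l gA gR <= p_quad l b c].
  rewrite !in_itv => /andP[agA gAb] /andP[cgR gRd].
  have gR0 := lt_le_trans c_gt0 cgR.
  split; rewrite // ?p_quad_mono_neg //; last exact: le_lt_trans gAb b_lt2.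
  by rewrite subr_gt0 (lt_trans l0) // (lt_le_trans a_gt0).
have [p_le0|p_gt0] := leP (p_quad l a d) 0.
  left; have /andP[lo _] := p_quad_le0 (ltW d_gt0) p_le0.
  rewrite in_itv /= lo p_quad_ge0_neg //=.
  (* The form of [schur_mx] at [y] has the sign of [l], so [p_quad] is nonnegative at the quotients
     of [y], hence at [(b, c)]. *)
  have [gA [gR [gA_ab gR_cd yq]]] := schur_mx_quotient eigenvector_y_neq0.
  have [gAl gR0 _ pbc] := box _ _ gA_ab gR_cd; apply: le_trans pbc.
  have yy : 0 < dot y y by rewrite dot_gt0 eigenvector_y_neq0.
  rewrite -(pmulr_lge0 _ yy) -oppr_le0 -mulNr -yq dot_schur_mx_y.
  rewrite pmulr_rle0 // nmulr_rle0 // addr_ge0 ?dot_ge0 //.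
(* Here [p_quad l] is positive on the whole box, which makes [- schur_mx] positive definite. *)
right; apply: (@schur_mx_spd_cubic (-1)); rewrite ?mulrNN ?mulr1 //; last exact: eigenvector_y_neq0.
rewrite scaleN1r; split=> [|u u0]; first by rewrite linearN /= schur_mx_sym.
rewrite dot_quadE; have [gA [gR [gA_ab gR_cd uq]]] := schur_mx_quotient u0.
have [gAl gR0 pad _] := box _ _ gA_ab gR_cd.
rewrite mulNmx dotNr -(pmulr_rgt0 _ gAl) mulrN uq mulNr opprK mulr_gt0 ?dot_gt0 //.
exact: lt_le_trans pad.
Qed.

End Symmetrized.

(** * The preconditioner *)

Section Preconditioner.
Variable R : realType.
Variables (n m p : nat) (B : 'M[R]_(m, n)) (C : 'M[R]_(p, m)).
Variables (A Ah : 'M[R]_n) (Sh : 'M[R]_m) (Xh : 'M[R]_p).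
Hypotheses (sAh : spd Ah) (sSh : spd Sh) (sXh : spd Xh).

Lemma precond_L_unit : precond_L B C Ah Sh Xh \in unitmx.
Proof.
rewrite unitmxE !det_lblock !unitrM -!unitmxE -(scaleN1r Sh) unitmxZ ?unitrN1 //.
by rewrite !spd_unit.
Qed.

Lemma precond_spd : spd (precond B C Ah Sh Xh).
Proof.
apply: spd_congr precond_L_unit _; apply: spd_inv.
exact: spd_block_diag sAh (spd_block_diag sSh sXh).
Qed.

Lemma saddle_mx_sym : A^T = A -> (saddle_mx B C A)^T = saddle_mx B C A.
Proof.
move=> Asym; rewrite tr_block_mx tr_row_mx tr_col_mx tr_block_mx Asym.
by rewrite !trmx0 !trmxK.
Qed.

Lemma mul_saddle_mx (x : 'cV[R]_n) (y : 'cV[R]_m) (z : 'cV[R]_p) :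
  saddle_mx B C A *m col_mx x (col_mx y z) =
  col_mx (A *m x + B^T *m y) (col_mx (B *m x + C^T *m z) (C *m y)).
Proof.
rewrite mul_block_col mul_row_col mul0mx addr0; congr col_mx.
by rewrite mul_block_col mul_col_mx !mul0mx addr0 add_col_mx add0r add0r.
Qed.

Lemma invmx_precond_D : invmx (precond_D Ah Sh Xh) = precond_D (invmx Ah) (invmx Sh) (invmx Xh).
Proof.
have Du : precond_D Ah Sh Xh \in unitmx.
  exact/spd_unit/(spd_block_diag sAh (spd_block_diag sSh sXh)).
apply: (row_full_inj (_ : row_full (precond_D Ah Sh Xh))); rewrite ?row_full_unit //.
rewrite mulmxV // !mulmx_block !mulmx0 !mul0mx !addr0 !add0r !mulmxV ?spd_unit //.
by rewrite -!scalar_mx_block.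
Qed.

(** The three factors are applied to the vector one after the other, so only the diagonal blocks get
    inverted. *)
Lemma mul_precond (x : 'cV[R]_n) (y : 'cV[R]_m) (z : 'cV[R]_p) :
  precond B C Ah Sh Xh *m col_mx x (col_mx y z) =
  col_mx (Ah *m x + B^T *m y)
    (col_mx (B *m x + B *m (invmx Ah *m (B^T *m y)) + Sh *m y - C^T *m z)
            (- (C *m y) + C *m (invmx Sh *m (C^T *m z)) + Xh *m z)).
Proof.
have LTu : (precond_L B C Ah Sh Xh)^T *m col_mx x (col_mx y z) =
    col_mx (Ah *m x + B^T *m y) (col_mx (C^T *m z - Sh *m y) (Xh *m z)).
  rewrite tr_block_mx tr_col_mx tr_block_mx !linearN /= !trmx0 !spd_sym //.
  rewrite !mul_block_col mul_row_col !mul0mx !addr0 !add0r.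
  by rewrite mulNmx [- _ + _]addrC.
rewrite /precond -!mulmxA LTu invmx_precond_D !mul_block_col !mul0mx !addr0 !add0r.
rewrite !mulmxDr !mulmxN !mulKmx ?spd_unit // mul_col_mx !mul_block_col.
rewrite !mul0mx !addr0 mulKVmx ?spd_unit //.
rewrite mul_col_mx !mul0mx !add_col_mx !add0r; congr (col_mx _ (col_mx _ _)).
  by rewrite mulNmx mulmxBr mulKVmx ?spd_unit // opprB -!addrA.
by rewrite mulmxBr [X in X + _ = _]addrC.
Qed.

End Preconditioner.

Lemma invmx_sqr (R : comUnitRingType) (n : nat) (H : 'M[R]_n) : H \in unitmx ->
  invmx (H *m H) = invmx H *m invmx H.
Proof.
move=> Hu; have HHu : H *m H \in unitmx by rewrite unitmx_mul Hu.
by rewrite -[RHS](mulmxK HHu) (mulmxA _ H H) mulmxKV // mulVmx // mul1mx.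
Qed.

Lemma rmorph_pi_cubic (F G : comNzRingType) (h : {rmorphism F -> G}) (l a b c : F) :
  pi_cubic (h l) (h a) (h b) (h c) = h (pi_cubic l a b c).
Proof.
by rewrite /pi_cubic /p_quad !(rmorph1, rmorph_nat, rmorphXn, rmorphD, rmorphN, rmorphM).
Qed.

Unset Implicit Arguments.
Set Strict Implicit.
Set Printing Implicit Defensive.

Theorem theorem2p2 (R : realType) (n m p : nat)
    (p_gt0 : (0 < p)%N) (le_pm : (p <= m)%N) (le_mn : (m <= n)%N)
    (A Ah : 'M[R]_n) (B : 'M[R]_(m, n)) (C : 'M[R]_(p, m))
    (Sh : 'M[R]_m) (Xh : 'M[R]_p)
    (spdA : spd A) (rankB : \rank B = m) (rankC : \rank C = p)
    (spdAh : spd Ah) (spdSh : spd Sh) (spdXh : spd Xh)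
    (gAmin gAmax gRmin gRmax gKmin gKmax : R)
    (gA_ext : extreme_eigenvalues (invmx Ah *m A) gAmin gAmax)
    (gR_ext : extreme_eigenvalues (invmx Sh *m schurS B Ah) gRmin gRmax)
    (gK_ext : extreme_eigenvalues (Kmx C Sh Xh *m (Kmx C Sh Xh)^T) gKmin gKmax)
    (gAmin_lt1 : gAmin < 1) (gAmax_gt1 : 1 < gAmax) (gAmax_lt2 : gAmax < 2)
    (IR1 : 1 \in `[gRmin, gRmax]) (IK1 : 1 \in `[gKmin, gKmax])
    (lambda : R[i]) :
  complex_eigenvalue (invmx (precond B C Ah Sh Xh) *m saddle_mx B C A) lambda ->
  (exists2 l : R, lambda = real_complex R l &
     l \in `[lambda_minus gAmin gRmax, lambda_minus gAmax gRmin] \/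
     l \in `[gAmin, lambda_plus gAmax gRmax])
  \/
  (exists gA gR gK : R,
     [/\ gA \in `[gAmin, gAmax], gR \in `[gRmin, gRmax],
         gK \in `[gKmin, gKmax] &
         pi_cubic lambda (real_complex R gA) (real_complex R gR)
                  (real_complex R gK) = 0]).
Proof.
have [sHA HA2] := spd_sqrtP spdAh; have [sHS HS2] := spd_sqrtP spdSh.
have [sHX HX2] := spd_sqrtP spdXh.
set HA := spd_sqrt Ah in sHA HA2; set HS := spd_sqrt Sh in sHS HS2.
set HX := spd_sqrt Xh in sHX HX2.
have [uA uS uX] := And3 (spd_unit sHA) (spd_unit sHS) (spd_unit sHX).
have VA := spd_sym (spd_inv sHA); have VS := spd_sym (spd_inv sHS).
have VX := spd_sym (spd_inv sHX).
have AhV : invmx Ah = invmx HA *m invmx HA by rewrite -HA2 invmx_sqr.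
have ShV : invmx Sh = invmx HS *m invmx HS by rewrite -HS2 invmx_sqr.
(* Blocks of the symmetrized pencil: [Ab] is similar to [invmx Ah *m A], [Q *m Q^T] to
   [invmx Sh *m schurS B Ah], and [K] is [Kmx C Sh Xh] itself. *)
pose Ab := invmx HA *m A *m invmx HA; pose Q := invmx HS *m B *m invmx HA.
pose K := invmx HX *m C *m invmx HS.
have KE : Kmx C Sh Xh = K by [].
have QT : Q^T = invmx HA *m B^T *m invmx HS by rewrite !trmx_mul VA VS mulmxA.
have KT : K^T = invmx HS *m C^T *m invmx HX by rewrite !trmx_mul VS VX mulmxA.
have sAb : spd Ab.
  by rewrite /Ab -{2}VA; apply: spd_congr; rewrite ?unitmx_inv.
(* Full row rank of [B] and [C] passes to [Q] and [K]; it makes both Gram matrices positive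
   definite, hence [gRmin] and [gKmin] positive. *)
have Qfree : row_free Q.
  rewrite /row_free /Q mxrankMfree ?row_free_unit ?unitmx_inv //.
  by rewrite eqmxMfull ?row_full_unit ?unitmx_inv // rankB.
have Kfree : row_free K.
  rewrite /row_free /K mxrankMfree ?row_free_unit ?unitmx_inv //.
  by rewrite eqmxMfull ?row_full_unit ?unitmx_inv // rankC.
have sQQ := spd_gram Qfree; have sKK := spd_gram Kfree.
have extA : extreme_eigenvalues Ab gAmin gAmax.
  by apply: (extreme_conj uA); rewrite /Ab !mulmxA mulmxKV // -AhV.
have extR : extreme_eigenvalues (Q *m Q^T) gRmin gRmax.
  apply: (extreme_conj uS); rewrite QT /Q !mulmxA mulmxKV // -ShV.
  by rewrite -(mulmxA (_ *m B)) -AhV -(mulmxA (invmx Sh)) -(mulmxA (invmx Sh)).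
rewrite KE in gK_ext.
have Ab_bd x := extreme_rayleigh x (spd_sym sAb) extA.
have Q_bd y : gRmin * dot y y <= dot (Q^T *m y) (Q^T *m y) <= gRmax * dot y y.
  by rewrite -dot_mulmxr mulmxA extreme_rayleigh // (spd_sym sQQ).
have K_bd z : gKmin * dot z z <= dot (K^T *m z) (K^T *m z) <= gKmax * dot z z.
  by rewrite -dot_mulmxr mulmxA extreme_rayleigh // (spd_sym sKK).
have gAmin_gt0 : 0 < gAmin by case: extA => /(spd_eigenvalue_gt0 sAb).
have gRmin_gt0 : 0 < gRmin by case: extR => /(spd_eigenvalue_gt0 sQQ).
have gKmin_gt0 : 0 < gKmin by case: gK_ext => /(spd_eigenvalue_gt0 sKK).
move=> /(sym_pencil_real (saddle_mx_sym B C (spd_sym spdA)) (precond_spd B C spdAh spdSh spdXh)).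
move=> [l [-> [u u0]]].
pose x := usubmx u; pose y := usubmx (dsubmx u); pose z := dsubmx (dsubmx u).
have uE : u = col_mx x (col_mx y z) by rewrite !vsubmxK.
rewrite uE mul_saddle_mx mul_precond // !scale_col_mx.
move=> /eq_col_mx[F1 /eq_col_mx[F2 F3]].
(* In these variables, multiplying each block row by the inverse root of its diagonal block gives
   [E1], [E2] and [E3]. *)
pose x' := HA *m x; pose y' := HS *m y; pose z' := HX *m z.
have Qx : Q *m x' = invmx HS *m (B *m x) by rewrite /x' !mulmxA mulmxKV.
have QTy : Q^T *m y' = invmx HA *m (B^T *m y) by rewrite QT /y' !mulmxA mulmxKV.
have Ky : K *m y' = invmx HX *m (C *m y) by rewrite /y' !mulmxA mulmxKV.
have KTz : K^T *m z' = invmx HS *m (C^T *m z) by rewrite KT /z' !mulmxA mulmxKV.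
have Ax : Ab *m x' = invmx HA *m (A *m x) by rewrite /x' !mulmxA mulmxKV.
have E1 : Ab *m x' + Q^T *m y' = l *: (x' + Q^T *m y').
  rewrite Ax QTy -mulmxDr F1 -scalemxAr mulmxDr; congr (_ *: (_ + _)).
  by rewrite -HA2 -mulmxA mulKmx.
have E2 : Q *m x' + K^T *m z' = l *: (Q *m x' + Q *m (Q^T *m y') + y' - K^T *m z').
  rewrite Qx KTz QTy -mulmxDr F2 -scalemxAr !mulmxDr mulmxN.
  congr (_ *: (_ + _ + _ - _)).
    by rewrite /Q AhV !mulmxA.
  by rewrite -HS2 -mulmxA mulKmx.
have E3 : K *m y' = l *: (- (K *m y') + K *m (K^T *m z') + z').
  rewrite Ky KTz {1}F3 -scalemxAr !mulmxDr mulmxN.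
  congr (_ *: (_ + _ + _)).
    by rewrite /K ShV !mulmxA.
  by rewrite -HX2 -mulmxA mulKmx.
have unit_neq0 k (H : 'M[R]_k) (v : 'cV[R]_k) : H \in unitmx -> (H *m v == 0) = (v == 0).
  move=> Hu; apply/eqP/eqP => [Hv|->]; last by rewrite mulmx0.
  by rewrite -(mulKmx Hu v) Hv mulmx0.
have nz : [|| x' != 0, y' != 0 | z' != 0].
  rewrite !unit_neq0 // -!negb_and; apply: contraNN u0 => /and3P[/eqP x0 /eqP y0 /eqP z0].
  by rewrite uE x0 y0 z0 !col_mx0.
have complexify : (exists gA gR gK : R,
     [/\ gA \in `[gAmin, gAmax], gR \in `[gRmin, gRmax],
         gK \in `[gKmin, gKmax] & pi_cubic l gA gR gK = 0]) ->
   exists gA gR gK : R,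
     [/\ gA \in `[gAmin, gAmax], gR \in `[gRmin, gRmax],
         gK \in `[gKmin, gKmax] &
         pi_cubic (real_complex R l) (real_complex R gA) (real_complex R gR)
                  (real_complex R gK) = 0].
  move=> [gA [gR [gK [? ? ? pi0]]]]; exists gA, gR, gK; split=> //.
  by rewrite rmorph_pi_cubic pi0 rmorph0.
have sAb_sym := spd_sym sAb.
have gRmax_ge0 : 0 <= gRmax.
  by move: IR1; rewrite in_itv => /andP[_ /(le_trans ler01)].
(* Outside the interval of [A] the matrix [Ab - l%:M] is invertible and [x] can be eliminated;
   inside it, [l] belongs to [I_+] directly. *)
have [la|al] := ltP l gAmin; last have [lb|bl] := leP l gAmax.
- have l_out : (l < gAmin) || (gAmax < l) by rewrite la.
  have l_neq0 := eigenvalue_neq0 Ab_bd Q_bd K_bd gAmin_gt0 gRmin_gt0 gKmin_gt0 E1 E2 E3 nz.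
  case: (ltgtP l 0) l_neq0 => // l0 _; last first.
    right; apply: complexify.
    exact: (cubic_below
      sAb_sym Ab_bd Q_bd K_bd gAmin_gt0 gRmin_gt0 gKmin_gt0
      l_out E1 E2 E3 nz l0 la).
  have [l_minus|cubic] := spectrum_negative
      sAb_sym Ab_bd Q_bd K_bd gAmin_gt0 gRmin_gt0 gKmin_gt0
      l_out E1 E2 E3 nz gAmax_lt2 IR1 l0.
    by left; exists l => //; left.
  by right; apply: complexify.
- left; exists l => //; right; rewrite in_itv /= al (le_trans lb) //.
  by case/andP: (p_quad_le0 gRmax_ge0 (p_quad_at_gA gAmax gRmax_ge0)).
- have l_out : (l < gAmin) || (gAmax < l) by rewrite bl orbT.
  right; apply: complexify.
  exact: (cubic_above
      sAb_sym Ab_bd Q_bd K_bd gAmin_gt0 gRmin_gt0 gKmin_gt0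
      l_out E1 E2 E3 nz gAmin_lt1 gAmax_gt1 IR1 IK1 bl).
Qed.
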